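(* Let $p$ be an odd prime and let $x$ be a variable. Then $$\sum_{k=0}^{p-1}\binom{2k}{k}^2\binom{3k}{k}\bigl(x(1-27x)\bigr)^k\equiv \Bigl(\sum_{k=0}^{p-1}\binom{2k}{k}\binom{3k}{k}x^k\Bigr)^2 \pmod{p^2}.$$
   Context: The congruence is between polynomials in $x$ with integer coefficients: it means that the difference of the two sides, as an element of $\mathbb{Z}[x]$, has all coefficients divisible by $p^2$. *)

(* Defs.v *)
From mathcomp Require Import all_boot all_order all_algebra.

Set Implicit Arguments.
Unset Strict Implicit.
Unset Printing Implicit Defensive.

Import GRing.Theory.
Local Open Scope ring_scope.

Definition eq_polyz_mod (m : int) (f g : {poly int}) : Prop :=
  forall i : nat, (m %| (f - g)`_i)%Z.

(* Main.v *)
Require Import Defs.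
From mathcomp Require Import all_boot all_order all_algebra.
From mathcomp Require Import ring zify.

Set Implicit Arguments.
Unset Strict Implicit.
Unset Printing Implicit Defensive.

Import GRing.Theory.
Local Open Scope ring_scope.

(** Put a_k = C(2k,k) C(3k,k) = (3k)!/k!^3 and P = X (1 - 27 X), and let
    f = sum_(k<p) a_k X^k and g = sum_(k<p) C(2k,k) a_k P^k, so that the claim
    is g = f^2 modulo p^2. Coefficients of degree below p and from p on behave
    differently.

    Below degree p the two sides are equal over the integers: this is a
    truncated form of the Clausen-type identity
       sum_k C(2k,k) a_k P^k = (sum_k a_k X^k)^2
    of formal power series. The recurrence of a_k says that the full series
    sum_k a_k X^k solves the self-adjoint equation (P f')' = 6 f. For any
    solution of that equation, f^2 solves its symmetric square, the third order
    equation
       (P (P F')')' = 12 (P F' + (P F)'),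
    and the identity P'^2 = 1 - 108 P makes this, in the variable P, the
    equation encoding the recurrence of C(2k,k) a_k. The truncations f and g
    satisfy these equations up to terms divisible by X^(p-1)
    ([hyp_ode], [symsq_sqr], [symsq_clausen]). Comparing lowest terms, the
    symmetric square operator sends c X^(n+1) + ... to (n+1)^3 c X^n + ...
    ([leads_symsq]), so a solution modulo X^(p-1) without constant term vanishes
    in all degrees below p ([symsq_uniq]); apply this to g - f^2.

    From degree p on, every term on both sides is a multiple of p^2. In f^2 the
    terms are a_i a_j with i, j < p <= i + j, and p divides a_i at least
    floor(3i/p) times, as i! is prime to p; these two floors add up to at
    least 2. In g, the polynomial P^k has degree 2k, so only those k with
    p <= 2k contribute, and for these p divides C(2k,k), which occurs squared. *)

(** * Recurrences for the binomial products *)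

Definition cubic_binom (k : nat) : nat := 'C(2 * k, k) * 'C(3 * k, k).

Lemma central_binom_fact k : ('C(2 * k, k) * k`! ^ 2 = (2 * k)`!)%N.
Proof.
have le_k : (k <= 2 * k)%N by lia.
by rewrite -(bin_fact le_k) (_ : 2 * k - k = k)%N; [rewrite mulnn | lia].
Qed.

Lemma cubic_binom_fact k : (cubic_binom k * k`! ^ 3 = (3 * k)`!)%N.
Proof.
have le_k : (k <= 3 * k)%N by lia.
rewrite -(bin_fact le_k) (_ : 3 * k - k = 2 * k)%N; last by lia.
by rewrite -central_binom_fact /cubic_binom expnS; ring.
Qed.

Lemma central_binomS k :
  (k.+1 * 'C(2 * k.+1, k.+1) = 2 * (2 * k + 1) * 'C(2 * k, k))%N.
Proof.
have k1_gt0 : (0 < k.+1 * k`! ^ 2)%N by rewrite muln_gt0 expn_gt0 fact_gt0.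
apply/eqP; rewrite -(eqn_pmul2r k1_gt0); apply/eqP.
have := central_binom_fact k.+1.
rewrite (_ : 2 * k.+1 = (2 * k).+2)%N; last by lia.
rewrite !factS -central_binom_fact => E.
by transitivity ('C((2 * k).+2, k.+1) * (k.+1 * k`!) ^ 2)%N;
  [ring | rewrite E; ring].
Qed.

Lemma cubic_binomS k :
  (k.+1 ^ 2 * cubic_binom k.+1 =
   3 * (3 * k + 1) * (3 * k + 2) * cubic_binom k)%N.
Proof.
have k1_gt0 : (0 < k.+1 * k`! ^ 3)%N by rewrite muln_gt0 expn_gt0 fact_gt0.
apply/eqP; rewrite -(eqn_pmul2r k1_gt0); apply/eqP.
have := cubic_binom_fact k.+1.
rewrite (_ : 3 * k.+1 = (3 * k).+3)%N; last by lia.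
rewrite !factS -cubic_binom_fact => E.
by transitivity (cubic_binom k.+1 * (k.+1 * k`!) ^ 3)%N;
  [ring | rewrite E; ring].
Qed.

(** * The differential equation and its symmetric square *)

(** The argument at which the series of C(2k,k)^2 C(3k,k) is taken; it is
    also the leading coefficient of the differential equation (P f')' = 6 f of
    the series with coefficients C(2k,k) C(3k,k). *)
Definition P : {poly int} := 'X * (1 - 27%:R *: 'X).

Lemma PE : P = 'X - 27%:R * 'X ^+ 2.
Proof. by rewrite /P scaler_nat; ring. Qed.

Lemma derivP : P^`() = 1 - 54%:R * 'X.
Proof.
by rewrite PE expr2 !mulr_natl derivB derivMn derivM derivX; ring.
Qed.

Lemma deriv_natl n (q : {poly int}) : (n%:R * q)^`() = n%:R * q^`().
Proof. by rewrite !mulr_natl derivMn. Qed.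

(** The symmetric square of (P f')' = 6 f: this operator annihilates every
    product of two solutions of that equation. *)
Definition symsq (h : {poly int}) : {poly int} :=
  (P * (P * h^`())^`())^`() - 12%:R * (P * h^`() + (P * h)^`()).

(** With u = P f', the rule u' = 6 f + e gives P (P (f^2)')' = 2 u^2 + 2 P f u';
    differentiating once more, the terms free of e are exactly those that the
    operator subtracts. The error e of a truncated solution appears only
    linearly and always with a factor P, which makes up for the one derivative
    that may fall on it. *)
Lemma symsq_sqr f e :
  (P * f^`())^`() = 6%:R * f + e ->
  symsq (f ^+ 2) = 4%:R * P * f^`() * e + 2%:R * (P * f * e)^`().
Proof.
move=> ode; set u := P * f^`() in ode *.
have -> : symsq (f ^+ 2) =
    (2%:R * (u * u + P * f * u^`()))^`()
    - 12%:R * (2%:R * f * u + (P * f ^+ 2)^`()).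
  have -> : 2%:R * (u * u + P * f * u^`()) = P * (P * (f ^+ 2)^`())^`().
    rewrite expr2 (derivM f f).
    rewrite (_ : P * (f^`() * f + f * f^`()) = (f * u) *+ 2).
      by rewrite derivMn (derivM f u) /u; ring.
    by rewrite /u; ring.
  have -> : 2%:R * f * u = P * (f ^+ 2)^`().
    by rewrite expr2 (derivM f f) /u; ring.
  by [].
rewrite ode.
have -> : 2%:R * (u * u + P * f * (6%:R * f + e)) =
    2%:R * (u * u) + (12%:R * (P * f ^+ 2) + 2%:R * (P * f * e)) by ring.
rewrite !derivD !deriv_natl (derivM u u) ode.
by rewrite /u; ring.
Qed.

Lemma symsqD g h : symsq (g + h) = symsq g + symsq h.
Proof. by rewrite /symsq !(derivD, mulrDr); ring. Qed.

Lemma symsqB g h : symsq (g - h) = symsq g - symsq h.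
Proof. by rewrite /symsq !(derivB, mulrBr); ring. Qed.

Lemma symsq_natl n h : symsq (n%:R * h) = n%:R * symsq h.
Proof.
have mulCA q r : q * (n%:R * r) = n%:R * (q * r) :> {poly int} by ring.
by rewrite /symsq !(deriv_natl, mulCA) -mulrDr mulCA -mulrBr.
Qed.

Lemma symsq1 : symsq 1 = (- 12%:R) * P^`().
Proof. by rewrite /symsq derivC !(mulr0, linear0) mulr1; ring. Qed.

Lemma deriv_expS (q : {poly int}) k :
  (q ^+ k.+1)^`() = k.+1%:R * (q ^+ k * q^`()).
Proof. by rewrite deriv_exp /= mulr_natl mulrC. Qed.

(** On powers of P the operator acts like a first-order recurrence in the
    exponent, times P', because P'^2 = 1 - 108 P and P'' is constant. The last
    coefficient is the one in the recurrence of C(2k,k)^2 C(3k,k). *)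
Lemma symsqP k :
  symsq (P ^+ k.+1) =
  P^`() * (k.+1%:R ^+ 3 * P ^+ k
    - (6 * (3 * k + 4) * (3 * k + 5) * (2 * k + 3))%:R * P ^+ k.+1).
Proof.
have sqP' : P^`() * P^`() = 1 - 108%:R * P by rewrite derivP PE; ring.
have P'' : P^`()^`() = - 54%:R.
  by rewrite derivP derivB deriv_natl derivX derivC; ring.
have D1 : P * (P ^+ k.+1)^`() = k.+1%:R * (P ^+ k.+1 * P^`()).
  by rewrite deriv_expS exprS; ring.
have D2 : P * (P * (P ^+ k.+1)^`())^`() =
    (k.+1 ^ 2)%:R * P ^+ k.+1 - (54 * k.+1 * (2 * k + 3))%:R * P ^+ k.+2.
  rewrite D1 deriv_natl derivM deriv_expS P''.
  transitivity (k.+1%:R * (k.+1%:R * P ^+ k.+1 * (P^`() * P^`())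
                - 54%:R * P ^+ k.+2)); first by rewrite !exprS; ring.
  by rewrite sqP' !exprS; ring.
rewrite /symsq D2 D1 -exprS derivB !deriv_natl !deriv_expS !exprS.
ring.
Qed.

(** * The two truncated series *)

Definition hyp (n : nat) : {poly int} :=
  \sum_(0 <= k < n) ('C(2 * k, k)%:R * 'C(3 * k, k)%:R) *: 'X^k.

Definition clausen (n : nat) : {poly int} :=
  \sum_(0 <= k < n) ('C(2 * k, k)%:R ^+ 2 * 'C(3 * k, k)%:R) *: P ^+ k.

Lemma hypS n : hyp n.+1 = hyp n + (cubic_binom n)%:R * 'X^n.
Proof.
by rewrite /hyp big_nat_recr //= -natrM scaler_nat mulr_natl.
Qed.

Lemma clausenS n :
  clausen n.+1 = clausen n + ('C(2 * n, n) * cubic_binom n)%:R * P ^+ n.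
Proof.
rewrite /clausen big_nat_recr //= -natrX -natrM scaler_nat mulr_natl.
by rewrite /cubic_binom mulnA mulnn.
Qed.

(** The recurrence of the coefficients makes the sum telescope: all that is left
    of the truncation is the first omitted coefficient, in degree n. *)
Lemma hyp_ode n :
  (P * (hyp n.+1)^`())^`() =
  6%:R * hyp n.+1 - (n.+1 ^ 2 * cubic_binom n.+1)%:R * 'X^n.
Proof.
elim: n => [|n IHn].
  rewrite hypS /hyp big_nil add0r expr0 mulr1 derivMn derivC mul0rn mulr0.
  rewrite derivC.
  by rewrite /cubic_binom !bin0 !bin1; ring.
rewrite hypS derivD mulrDr derivD IHn.
have -> : (P * ((cubic_binom n.+1)%:R * 'X^(n.+1))^`())^`() =
    (cubic_binom n.+1)%:R * ((n.+1 ^ 2)%:R * 'X^n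
     - (27 * n.+1 * n.+2)%:R * 'X^(n.+1)).
  rewrite deriv_natl deriv_expS derivX.
  rewrite (_ : P * _ = (cubic_binom n.+1 * n.+1)%:R * 'X^(n.+1)
            - (cubic_binom n.+1 * n.+1 * 27)%:R * 'X^(n.+2)); last first.
    by rewrite PE !exprS; ring.
  by rewrite derivB !deriv_natl !deriv_expS derivX; ring.
rewrite (cubic_binomS n.+1).
by rewrite !exprS; ring.
Qed.

(** The analogous telescoping in powers of P. The remainder is divisible by X^n
    because P is divisible by X. *)
Lemma symsq_clausen n :
  symsq (clausen n.+1) =
  - (n.+1 ^ 3 * ('C(2 * n.+1, n.+1) * cubic_binom n.+1))%:R * (P ^+ n * P^`()).
Proof.
elim: n => [|n IHn].
  rewrite clausenS /clausen big_nil add0r expr0 !mulr1 !bin0 symsq1.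
  by rewrite /cubic_binom !bin1; ring.
rewrite clausenS symsqD IHn symsq_natl symsqP.
have -> : (n.+2 ^ 3 * ('C(2 * n.+2, n.+2) * cubic_binom n.+2)
   = 6 * (3 * n + 4) * (3 * n + 5) * (2 * n + 3)
     * ('C(2 * n.+1, n.+1) * cubic_binom n.+1))%N.
  transitivity ((n.+2 * 'C(2 * n.+2, n.+2)) * (n.+2 ^ 2 * cubic_binom n.+2))%N.
    by ring.
  by rewrite central_binomS cubic_binomS; ring.
by rewrite !exprS; ring.
Qed.

(** * Uniqueness through lowest terms *)

(** States q = c X^n + O(X^(n+1)). The value c = 0 is allowed, so that lower
    order terms of an expression fit the same predicate. *)
Definition leads (n : nat) (c : int) (q : {poly int}) :=
  forall i, (i <= n)%N -> q`_i = c *+ (i == n).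

Lemma leads_deriv n c q : leads n.+1 c q -> leads n (c *+ n.+1) q^`().
Proof.
move=> lead_q i le_in; rewrite coef_deriv lead_q // eqSS.
by case: eqP => [-> //|_]; rewrite !mul0rn mulr0n.
Qed.

Lemma leads_mulP n c q : leads n c q -> leads n.+1 c (P * q).
Proof.
move=> lead_q i le_in.
rewrite (_ : P * q = 'X * q - 'X * ('X * q) *+ 27); last by rewrite PE; ring.
rewrite coefB coefMn !coefXM.
case: i le_in => [|[|i]] le_in /=; first by rewrite mul0rn subr0.
  by rewrite lead_q // mul0rn subr0.
have lt_in : (i < n)%N := le_in.
by rewrite !lead_q // ?(ltnW lt_in) // (ltn_eqF lt_in) mulr0n mul0rn subr0.
Qed.

Lemma leads_weak n c q : leads n.+1 c q -> leads n 0 q.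
Proof.
by move=> lead_q i le_in; rewrite lead_q ?(leqW le_in) // ltn_eqF // mul0rn.
Qed.

(** Only (P (P h')')' reaches degree n: each of the three derivatives contributes
    a factor n + 1, and each P raises the degree back by one. The subtracted
    part starts one degree higher. *)
Lemma leads_symsq n c h : leads n.+1 c h -> leads n (c *+ n.+1 ^ 3) (symsq h).
Proof.
move=> lead_h.
have lead_Ph' := leads_mulP (leads_deriv lead_h).
have lead0_Ph' := leads_weak lead_Ph'.
have lead0_Phd := leads_weak (leads_deriv (leads_mulP lead_h)).
have lead_main := leads_deriv (leads_mulP (leads_deriv lead_Ph')).
move=> i le_in; rewrite /symsq coefB mulr_natl coefMn coefD.
rewrite lead_main // lead0_Ph' // lead0_Phd // !(mul0rn, addr0, subr0).
by rewrite -!mulrnA; congr (_ *+ _); ring.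
Qed.

(** The indicial polynomial r^3 has no positive root, so the equation
    determines each coefficient from the previous ones, starting from the
    constant term. *)
Lemma symsq_uniq n (h k : {poly int}) : h`_0 = 0 -> symsq h = 'X^n * k ->
  forall i, (i <= n)%N -> h`_i = 0.
Proof.
move=> h0 symsq_h i; elim/ltn_ind: i => -[|i] IHi //= lt_in.
have lead_h : leads i.+1 h`_i.+1 h.
  move=> j; rewrite leq_eqVlt => /predU1P[-> | lt_ji]; first by rewrite eqxx.
  by rewrite ltn_eqF // mulr0n IHi // (leq_trans _ lt_in) // ltnW.
have := leads_symsq lead_h (leqnn i).
rewrite symsq_h coefXnM lt_in eqxx => /esym/eqP.
by rewrite mulr1n Num.Theory.mulrn_eq0 expn_eq0 => /eqP.
Qed.

Lemma hyp0 n : (hyp n.+1)`_0 = 1.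
Proof.
elim: n => [|n IHn]; rewrite hypS coefD mulr_natl coefMn coefXn /=.
  by rewrite /hyp big_nil coef0 add0r /cubic_binom !bin0.
by rewrite IHn mul0rn addr0.
Qed.

Lemma clausen0 n : (clausen n.+1)`_0 = 1.
Proof.
elim: n => [|n IHn]; rewrite clausenS coefD mulr_natl coefMn.
  by rewrite /clausen big_nil coef0 add0r coef1 /cubic_binom !bin0.
by rewrite IHn exprS {1}/P -mulrA coefXM mul0rn addr0.
Qed.

(** The Clausen-type identity, valid below the truncation degree. *)
Lemma clausen_low n i :
  (i <= n)%N -> (clausen n.+1 - hyp n.+1 ^+ 2)`_i = 0.
Proof.
set f := hyp n.+1; set g := clausen n.+1.
set c := (n.+1 ^ 2 * cubic_binom n.+1)%N.
set b := (n.+1 ^ 3 * ('C(2 * n.+1, n.+1) * cubic_binom n.+1))%N.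
set w : {poly int} := 1 - 27%:R *: 'X.
have wX : P = 'X * w by [].
(* The witness is the sum of the three remainders with X^n factored out; in
   2 (P f e)' the factor X of P compensates for the derivative. *)
apply: (@symsq_uniq n _
  (- b%:R * w ^+ n * P^`() + 4%:R * c%:R * P * f^`()
   + 2%:R * c%:R * (n.+1%:R * (w * f) + 'X * (w * f)^`()))).
  by rewrite coefB expr2 coefM big_ord1 subnn hyp0 clausen0 mulr1 subrr.
rewrite symsqB /g symsq_clausen -/b.
rewrite (symsq_sqr (hyp_ode n)) -/f -/c.
have -> : P * f * - (c%:R * 'X^n) = - (c%:R * ('X^(n.+1) * (w * f))).
  by rewrite wX exprS; ring.
rewrite derivN deriv_natl (derivM 'X^(n.+1)) deriv_expS derivX.
by rewrite [P ^+ n]exprMn exprS; ring.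
Qed.

(** * Divisibility by the square of the prime *)

Lemma expn_dvd_fact p d : (0 < p)%N -> (p ^ d %| (d * p)`!)%N.
Proof.
move=> p_gt0; elim: d => [|d IHd]; first by rewrite dvd1n.
have le_p : (p <= d.+1 * p)%N by rewrite leq_pmull.
rewrite -(bin_fact le_p) dvdn_mull // expnS.
rewrite (_ : d.+1 * p - p = d * p)%N ?mulSn ?addKn // dvdn_mul //.
by rewrite dvdn_fact ?p_gt0 /=.
Qed.

Lemma expn_dvd_fact_le p d n : (0 < p)%N -> (d * p <= n)%N -> (p ^ d %| n`!)%N.
Proof.
move=> p_gt0 /bin_fact <-.
by rewrite dvdn_mull // dvdn_mulr // expn_dvd_fact.
Qed.

Lemma coprime_expn_fact p d k : prime p -> (k < p)%N -> coprime (p ^ d) k`!.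
Proof.
move=> p_pr lt_kp; apply: coprimeXl; rewrite prime_coprime //.
elim: k lt_kp => [|k IHk] lt_kp.
  by rewrite dvdn1; case: eqP p_pr => // ->.
rewrite factS Euclid_dvdM // negb_or gtnNdvd //=.
by apply: IHk; apply: ltnW.
Qed.

Lemma dvd_central_binom p k :
  prime p -> (k < p)%N -> (p <= 2 * k)%N -> (p %| 'C(2 * k, k))%N.
Proof.
move=> p_pr lt_kp le_p2k.
have := @expn_dvd_fact_le p 1 (2 * k) (prime_gt0 p_pr).
rewrite mul1n => /(_ le_p2k).
rewrite -central_binom_fact Gauss_dvdl ?expn1 //.
by have := coprime_expn_fact 1 p_pr lt_kp; rewrite expn1 => /coprimeXr; apply.
Qed.

Lemma dvd_cubic_binom p k :
  prime p -> (k < p)%N -> (p ^ (3 * k %/ p) %| cubic_binom k)%N.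
Proof.
move=> p_pr lt_kp.
have := expn_dvd_fact_le (prime_gt0 p_pr) (leq_trunc_div (3 * k) p).
rewrite -cubic_binom_fact Gauss_dvdl //.
exact/coprimeXr/coprime_expn_fact.
Qed.

(** From 3i + 3j >= 3p, the sum of floor(3i/p) and floor(3j/p) exceeds 1, since
    each floor loses less than one unit. *)
Lemma dvd_cubic_binomM p i j : prime p -> (i < p)%N -> (j < p)%N ->
  (p <= i + j)%N -> (p ^ 2 %| cubic_binom i * cubic_binom j)%N.
Proof.
move=> p_pr lt_ip lt_jp le_pij; have p_gt0 := prime_gt0 p_pr.
apply: dvdn_trans (dvdn_mul (dvd_cubic_binom p_pr lt_ip)
                            (dvd_cubic_binom p_pr lt_jp)).
rewrite -expnD dvdn_exp2l //.
have := ltn_ceil (3 * i) p_gt0; have := ltn_ceil (3 * j) p_gt0.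
by nia.
Qed.

Lemma coef_hyp n i : (hyp n)`_i = (if (i < n)%N then cubic_binom i else 0%N)%:R.
Proof.
elim: n => [|n IHn]; first by rewrite /hyp big_nil coef0.
rewrite hypS coefD IHn mulr_natl coefMn coefXn ltnS [in RHS]leq_eqVlt.
case: eqP => [->|_] /=; last by rewrite mul0rn addr0.
by rewrite ltnn add0r.
Qed.

Lemma dvd_coef_hyp_sqr p i : prime p -> (p <= i)%N ->
  (p%:Z ^+ 2 %| (hyp p ^+ 2)`_i)%Z.
Proof.
move=> p_pr le_pi; rewrite expr2 coefM; apply: rpred_sum => j _.
rewrite !coef_hyp -natrM natz dvdzE abszX /=.
case: ifP => lt_j; last by rewrite mul0n dvdn0.
case: ifP => lt_ij; last by rewrite muln0 dvdn0.
by apply: dvd_cubic_binomM; rewrite // subnKC // -ltnS.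
Qed.

(** Since P^k has degree 2k, the summands with 2k < p do not reach degree p; in
    the other ones C(2k,k) is a multiple of p. *)
Lemma dvd_coef_clausen p i : prime p -> (p <= i)%N ->
  (p%:Z ^+ 2 %| (clausen p)`_i)%Z.
Proof.
move=> p_pr le_pi; rewrite /clausen big_mkord coef_sum.
apply: rpred_sum => k _; rewrite coefZ.
have [le_p2k | lt_2kp] := leqP p (2 * k).
  apply/dvdz_mulr/dvdz_mulr/dvdz_exp2r.
  by rewrite natz; apply: dvd_central_binom.
rewrite nth_default ?mulr0 ?dvdz0 //.
apply: leq_trans (size_poly_exp_leq _ _) _.
have size_P : (size P <= 3)%N.
  rewrite PE; apply: leq_trans (size_polyD _ _) _.
  rewrite size_polyX size_polyN mulr_natl -scaler_nat geq_max /=.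
  by apply: leq_trans (size_scale_leq _ _) _; rewrite size_polyXn.
nia.
Qed.

Theorem theorem2p1 (p : nat) (p_prime : prime p) (p_odd : odd p) :
  eq_polyz_mod (p%:Z ^+ 2)
    (\sum_(0 <= k < p)
       ('C(2 * k, k)%:R ^+ 2 * 'C(3 * k, k)%:R) *: ('X * (1 - 27%:R *: 'X)) ^+ k)
    ((\sum_(0 <= k < p) ('C(2 * k, k)%:R * 'C(3 * k, k)%:R) *: 'X^k) ^+ 2).
Proof.
move=> i; rewrite -/P -/(clausen p) -/(hyp p).
have [le_pi | lt_ip] := leqP p i.
  by rewrite coefB rpredB ?dvd_coef_clausen ?dvd_coef_hyp_sqr.
case: p {p_prime p_odd} lt_ip => // n lt_in.
by rewrite clausen_low ?dvdz0.
Qed.
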